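(* For $n\ge2$ let $\mathbb{E}_n(|x(\tau)|)$ denote the expected value of $|x(\tau)|$ when $\tau$ is chosen uniformly at random from $\mathcal{S}_n$. The limit of $\mathbb{E}_n(|x(\tau)|)$ as $n$ goes to infinity exists and $$e-1\le\lim_{n\to\infty}\mathbb{E}_n(|x(\tau)|)\le e.$$
   Context: $\mathcal{S}_n$ is the set of permutations of $\{1,\dots,n\}$ in one-line notation $\tau=\tau_1\tau_2\dots\tau_n$, with $|\tau|=n$. The reduction of a sequence of $k$ distinct positive integers is the permutation in $\mathcal{S}_k$ obtained by replacing the smallest entry by $1$, the second smallest by $2$, and so on. For $1\le i\le j\le n$, $\tau_{[i,j]}\in\mathcal{S}_{j-i+1}$ is the reduction of $\tau_i\dots\tau_j$. For $\tau\in\mathcal{S}_n$ with $n\ge2$, a bifix of $\tau$ is a permutation that is both a proper prefix and a proper suffix of $\tau$, i.e. a permutation $\sigma=\tau_{[1,i]}=\tau_{[n-i+1,n]}$ for some $1\le i\le n-1$. The exterior $x(\tau)$ is the longest bifix of $\tau$ (it exists because the permutation $1$ is always a bifix). *)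

(* Defs.v *)
From HB Require Import structures.
From mathcomp Require Import all_boot all_order all_fingroup all_algebra.
From mathcomp Require Import all_classical all_reals all_analysis.
From mathcomp Require Import zify.

Set Implicit Arguments.
Unset Strict Implicit.
Unset Printing Implicit Defensive.

Import Order.TTheory GRing.Theory Num.Theory.
Import numFieldNormedType.Exports.

(* Permutations are handled through their one-line notation, a word on the
   letters 1, ..., n, so that permutations of different lengths can be compared
   without transporting along equalities between lengths. *)
Definition one_line n (tau : 'S_n) : seq nat :=
  [seq (val (tau i)).+1 | i <- enum 'I_n].

(* For a word with distinct letters, the rank of x (counted from 1) is the number
   of letters that are at most x. *)
Definition reduction (s : seq nat) : seq nat :=
  [seq count (fun y => y <= x)%N s | x <- s].

(* tau_[i,j], with 1-based positions 1 <= i <= j <= size t. *)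
Definition factor (t : seq nat) (i j : nat) : seq nat :=
  reduction (drop i.-1 (take j t)).

Definition bifix_at (t : seq nat) (i : nat) : bool :=
  factor t 1 i == factor t (size t - i + 1)%N (size t).

Definition is_bifix (t sigma : seq nat) : Prop :=
  exists i : nat, [/\ (1 <= i <= (size t).-1)%N,
    sigma = factor t 1 i & sigma = factor t (size t - i + 1)%N (size t)].

Definition exterior (t : seq nat) : seq nat :=
  factor t 1 (\max_(1 <= i < size t | bifix_at t i) i)%N.

Definition expected_exterior_size (R : realType) (n : nat) : R :=
  ((\sum_(tau : 'S_n) (size (exterior (one_line tau)))%:R) / #|{: 'S_n}|%:R)%R.

Lemma size_one_line n (tau : 'S_n) : size (one_line tau) = n.
Proof. by rewrite size_map size_enum_ord. Qed.

Lemma one_line_uniq n (tau : 'S_n) : uniq (one_line tau).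
Proof.
rewrite map_inj_uniq ?enum_uniq // => i j /eqP.
by rewrite eqSS => /eqP /val_inj /perm_inj.
Qed.

Lemma size_reduction s : size (reduction s) = size s.
Proof. exact: size_map. Qed.

Lemma reduction_perm s : uniq s -> perm_eq (reduction s) (iota 1 (size s)).
Proof.
move=> us; have ur : uniq (reduction s).
  rewrite map_inj_in_uniq // => x y xs ys.
  wlog xy : x y xs ys / (x <= y)%N => [W E|E].
    by case: (leqP x y) => [/W|/ltnW/W] H; [exact: H|apply/esym/H].
  apply/eqP; rewrite eqn_leq xy /=; apply: contraT; rewrite -ltnNge => lt_xy.
  have := count_predUI (fun z => z <= x)%N (pred1 y) s.
  have -> : count (predI (fun z => z <= x)%N (pred1 y)) s = 0%N.
    apply/eqP; rewrite -leqn0 leqNgt -has_count; apply/hasPn => z _ /=.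
    by apply/negP => /andP[zx /eqP zy]; move: zx; rewrite zy leqNgt lt_xy.
  rewrite addn0 count_uniq_mem // ys => HU.
  have : (count (predU (fun z => z <= x) (pred1 y)) s
          <= count (fun z => z <= y) s)%N.
    by apply: sub_count => z /= /orP[/leq_trans->//|/eqP->].
  by rewrite HU E addn1 ltnn.
apply: uniq_perm => //; first exact: iota_uniq.
apply: (uniq_min_size ur _ _).2.
  move=> k /mapP[x xs ->]; rewrite mem_iota add1n ltnS count_size andbT.
  by rewrite -has_count; apply/hasP; exists x.
by rewrite size_iota size_reduction.
Qed.

Lemma size_factor_prefix t i : (i <= size t)%N -> size (factor t 1 i) = i.
Proof. by move=> it; rewrite size_reduction drop0 size_takel. Qed.

Lemma bifix1 t : (2 <= size t)%N -> bifix_at t 1.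
Proof.
move=> t2; rewrite /bifix_at /factor /= drop0 take_size.
have red1 s : size s = 1%N -> reduction s = [:: 1%N].
  by case: s => [|x []] //= _; rewrite /reduction /= leqnn.
by rewrite !red1 ?size_takel ?size_drop //; lia.
Qed.

Lemma exterior_longest_bifix t : (2 <= size t)%N ->
  is_bifix t (exterior t) /\
  (forall sigma, is_bifix t sigma -> (size sigma <= size (exterior t))%N).
Proof.
move=> t2; rewrite /exterior.
set m := (\max_(1 <= i < size t | bifix_at t i) i)%N.
have le_m i : (1 <= i < size t)%N -> bifix_at t i -> (i <= m)%N.
  by move=> it bi; apply: leq_bigmax_seq; rewrite ?mem_index_iota.
have m1 : (1 <= m)%N by apply: le_m => //; exact: bifix1.
have [m0|[mt bm]] : m = 0%N \/ (m < size t)%N /\ bifix_at t m.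
- rewrite /m big_nat_cond; elim/big_ind: _ => [|x y|i]; first by left.
    by case=> [->|Px] [->|Py]; rewrite ?maxn0 ?max0n;
      [left|right|right|right; rewrite /maxn; case: ifP].
  by case/andP => /andP[_ ? ?]; right.
- by rewrite m0 in m1.
split; first by exists m; split; [lia| |exact/eqP].
move=> sigma [i [it e1 e2]].
rewrite e1 !size_factor_prefix; [|lia..].
by apply: le_m; [lia|rewrite /bifix_at -e1 -e2].
Qed.

(* Main.v *)
Require Import Defs.
From HB Require Import structures.
From mathcomp Require Import all_boot all_order all_fingroup all_algebra.
From mathcomp Require Import all_classical all_reals all_analysis.
From mathcomp Require Import zify.
Import Order.TTheory GRing.Theory Num.Theory.
Import numFieldNormedType.Exports.
Local Open Scope classical_set_scope.
Local Open Scope ring_scope.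

(** Write X for the length of the exterior and, for a bound K, let Y_K be the
    length of the longest bifix of length at most K.

    If 2K <= n, then Y_K depends only on the order patterns of the first K and
    of the last K letters. These two windows are disjoint, so their patterns are
    independent and uniform on S_K, whatever n is
    ([two_window_equidistribution]: average over the permutations of positions
    inside each window). Hence E(Y_K) is a number c_K ([short_mean]) free of n,
    and c_K is nondecreasing in K. A bifix of length i <= K occurs with
    probability 1/i!, and Y_K lies between the number of bifixes of length at
    most K and the sum of their lengths. Therefore
      sum_(1 <= i <= K) 1/i! <= c_K <= sum_(1 <= i <= K) i/i!,
    so c_K converges, to a limit between e - 1 and e.

    It remains to see that the bifixes longer than n/2 do not matter. Such a
    bifix makes the order pattern of tau invariant under a shift by d < n/2,
    hence under all multiples of d, and one of these multiples, D, lies between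
    n/4 and n/2 ([long_bifix_repetition]). The two adjacent blocks of length D
    at the start of tau are then order isomorphic, which has probability 1/D!.
    With the crude bound X <= n, this gives
      c_(n/2) <= E(X) <= c_(n/2) + n * sum_(n/4 <= D <= n/2) 1/D!,
    whose error term tends to 0; the limit of E(X) is that of c_K. *)

(** * Order isomorphism of words and ranks *)

Section Combinatorics.
Set Implicit Arguments.
Unset Strict Implicit.
Unset Printing Implicit Defensive.
Local Open Scope nat_scope.

(** Words are functions on nat of which only the first K letters count: this
    lets windows of different words be compared, and shifted, without casts
    between ordinal types. *)
Definition order_iso (K : nat) (u v : nat -> nat) : bool :=
  [forall a : 'I_K, forall b : 'I_K, (u a <= u b) == (v a <= v b)].

Lemma order_isoP K u v :
  reflect (forall a b, a < K -> b < K -> (u a <= u b) = (v a <= v b))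
          (order_iso K u v).
Proof.
apply: (iffP forallP) => [H a b aK bK|H a].
  by move/forallP: (H (Ordinal aK)) => /(_ (Ordinal bK))/eqP.
by apply/forallP => b; rewrite H.
Qed.

Lemma order_iso_sym K u v : order_iso K u v = order_iso K v u.
Proof. by apply/order_isoP/order_isoP => H a b aK bK; rewrite H. Qed.

Lemma order_iso_trans K v u w :
  order_iso K u v -> order_iso K v w -> order_iso K u w.
Proof.
move=> /order_isoP H /order_isoP H'; apply/order_isoP => a b aK bK.
by rewrite H // H'.
Qed.

Definition rank (K : nat) (u : nat -> nat) (a : nat) : nat :=
  \sum_(b < K) (u b <= u a).

Lemma leq_rank K u a b : a < K -> b < K ->
  (rank K u a <= rank K u b) = (u a <= u b).
Proof.
move=> aK bK; case: (leqP (u a) (u b)) => [ab|ba].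
  by apply: leq_sum => i _; case: (leqP (u i) (u a)) => // /leq_trans ->.
apply/negbTE; rewrite -ltnNge /rank (bigD1 (Ordinal aK)) //=.
rewrite [X in _ < X](bigD1 (Ordinal aK)) //= leqnn (leqNgt (u a)) ba add0n.
rewrite add1n ltnS; apply: leq_sum => i _.
by case: (leqP (u i) (u b)) => // ib; rewrite (leq_trans ib (ltnW ba)).
Qed.

Lemma eq_rank K u v a : order_iso K u v -> a < K -> rank K u a = rank K v a.
Proof. by move=> /order_isoP H aK; apply: eq_bigr => b _; rewrite H. Qed.

(** Over indices instead of letters, the count defining [reduction] is a rank,
    so that reductions can be compared through [order_iso]. *)
Lemma nth_reduction s a : a < size s ->
  nth 0 (reduction s) a = rank (size s) (nth 0 s) a.
Proof.
move=> sa; rewrite (nth_map 0) // -[in LHS](mkseq_nth 0 s) count_map.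
rewrite nth_mkseq // -sum1_count big_mkcond -{1}[size s]subn0.
rewrite -/(index_iota 0 _) big_mkord.
by apply: eq_bigr => b _ /=; case: (_ <= _).
Qed.

Lemma eq_reduction s t : size s = size t ->
  (reduction s == reduction t) = order_iso (size s) (nth 0 s) (nth 0 t).
Proof.
move=> st; apply/eqP/order_isoP => [E a b sa sb|/order_isoP E].
  rewrite -(@leq_rank (size s)) // -!nth_reduction // E.
  by rewrite !nth_reduction -?st // leq_rank.
apply: (@eq_from_nth _ 0); rewrite !size_reduction // => a sa.
by rewrite !nth_reduction -?st //; apply: eq_rank.
Qed.

(** * Permutations as words *)

(** A permutation acting on all of nat, as the identity beyond its domain. Its
    letters start at 0, one less than in [one_line], which is harmless for
    order patterns. *)
Definition ext n (tau : 'S_n) (a : nat) : nat :=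
  if insub a is Some i then (tau i : nat) else a.

Lemma ext_ord n (tau : 'S_n) (i : 'I_n) : ext tau i = tau i.
Proof. by rewrite /ext valK. Qed.

Lemma ltn_ext n (tau : 'S_n) a : a < n -> ext tau a < n.
Proof. by move=> an; rewrite (ext_ord tau (Ordinal an)). Qed.

Lemma ext_out n (tau : 'S_n) a : n <= a -> ext tau a = a.
Proof. by move=> na; rewrite /ext insubF // ltnNge na. Qed.

Lemma ext_inj n (tau : 'S_n) : injective (ext tau).
Proof.
move=> a b; case: (ltnP a n) => an; case: (ltnP b n) => bn.
- rewrite (ext_ord tau (Ordinal an)) (ext_ord tau (Ordinal bn)).
  by move=> /val_inj/perm_inj/(congr1 val).
- by rewrite (ext_out _ bn) => E; have := ltn_ext tau an; rewrite E ltnNge bn.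
- by rewrite (ext_out _ an) => E; have := ltn_ext tau bn; rewrite -E ltnNge an.
- by rewrite !ext_out.
Qed.

Lemma extM n (s t : 'S_n) a : ext (s * t)%g a = ext t (ext s a).
Proof.
case: (ltnP a n) => an; last by rewrite !(ext_out _ an).
by rewrite !(ext_ord _ (Ordinal an)) permM ext_ord.
Qed.

Lemma ext_surj n (g : nat -> nat) :
  (forall a, a < n -> g a < n) ->
  (forall a b, a < n -> b < n -> g a = g b -> a = b) ->
  exists s : 'S_n, forall a, a < n -> ext s a = g a.
Proof.
move=> gn ginj; pose f (i : 'I_n) := Ordinal (gn i (ltn_ord i)).
have finj : injective f.
  by move=> i j /(congr1 val) /= /ginj E; apply: val_inj; apply: E.
by exists (perm finj) => a an; rewrite (ext_ord _ (Ordinal an)) permE.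
Qed.

Lemma nth_one_line n (tau : 'S_n) a : a < n ->
  nth 0 (one_line tau) a = (ext tau a).+1.
Proof.
move=> an; rewrite (nth_map (Ordinal an)) ?size_enum_ord //.
by rewrite (nth_ord_enum (Ordinal an) (Ordinal an)) (ext_ord _ (Ordinal an)).
Qed.

Definition shift (s : nat) (u : nat -> nat) (a : nat) := u (s + a).

Lemma bifix_atE n (tau : 'S_n) i : 0 < i <= n ->
  bifix_at (one_line tau) i = order_iso i (ext tau) (shift (n - i) (ext tau)).
Proof.
move=> /andP[i0 le_in]; rewrite /bifix_at size_one_line addn1.
have -> : Defs.factor (one_line tau) 1 i = reduction (take i (one_line tau)).
  by rewrite /Defs.factor drop0.
have -> : Defs.factor (one_line tau) (n - i).+1 n = reduction (drop (n - i) (one_line tau)).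
  by rewrite /Defs.factor take_oversize ?size_one_line.
have size_take_i : size (take i (one_line tau)) = i.
  by rewrite size_takel ?size_one_line.
rewrite eq_reduction size_take_i ?size_drop ?size_one_line ?subKn //.
apply/order_isoP/order_isoP => H a b ai bi; move: (H a b ai bi);
  by rewrite !nth_drop !nth_take // !nth_one_line //; lia.
Qed.

(** A permutation is its own standardization: the rank of each of its letters
    is that letter, up to the offset of 1 between ranks and letters. *)
Lemma order_iso_perm n (s t : 'S_n) : order_iso n (ext s) (ext t) = (s == t).
Proof.
apply/idP/eqP => [E|->]; last exact/order_isoP.
have rankE (r : 'S_n) (a : 'I_n) : rank n (ext r) a = \sum_(y < n) (y <= r a).
  rewrite [RHS](reindex_inj (@perm_inj _ r)) /rank.
  by apply: eq_bigr => b _; rewrite !ext_ord.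
have sum_le (x : 'I_n) : \sum_(y < n) (y <= x) = x.+1.
  rewrite -[LHS](big_mkord xpredT (fun y => nat_of_bool (y <= x))).
  rewrite (@big_cat_nat _ _ _ x.+1) //= big_nat_cond (eq_bigr (fun=> 1)).
    rewrite -big_nat_cond sum_nat_const_nat subn0 muln1 big_nat_cond big1 ?addn0 //.
    by move=> y /andP[/andP[xy _] _]; rewrite leqNgt xy.
  by move=> y /andP[/andP[_ ]]; rewrite ltnS => -> _.
apply/permP => a; apply/val_inj/succn_inj; rewrite -!sum_le -!rankE.
exact: eq_rank.
Qed.

(** Order patterns of windows are represented by permutations: the pattern of a
    word with distinct letters is its rank function. *)
Lemma standardization K u : (forall a b, a < K -> b < K -> u a = u b -> a = b) ->
  exists p : 'S_K, order_iso K u (ext p).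
Proof.
move=> uinj.
have rank0 a : a < K -> 0 < rank K u a.
  by move=> aK; rewrite /rank (bigD1 (Ordinal aK)) //= leqnn.
have [||p pE] := @ext_surj K (fun a => (rank K u a).-1).
- move=> a aK; rewrite prednK ?rank0 //.
  apply: (@leq_trans (\sum_(b < K) 1)); last by rewrite sum_nat_const card_ord muln1.
  by apply: leq_sum => b _; exact: leq_b1.
- move=> a b aK bK E; apply: uinj => //; apply/eqP.
  have R : rank K u a = rank K u b by rewrite -(prednK (rank0 _ aK)) E prednK ?rank0.
  by rewrite eqn_leq -(@leq_rank K u a b) // -(@leq_rank K u b a) // R leqnn.
exists p; apply/order_isoP => a b aK bK; rewrite !pE // -(@leq_rank K u a b) //.
by have := rank0 _ aK; have := rank0 _ bK; lia.
Qed.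

(** * Equidistribution of the patterns of two disjoint windows *)

Lemma block_perm_exists n K s (al : 'S_K) : s + K <= n ->
  exists sg : 'S_n, forall a, a < n ->
    ext sg a = if s <= a < s + K then s + ext al (a - s) else a.
Proof.
move=> sKn; apply: ext_surj => [a an|a b an bn].
  by case: ifP => // H; have := @ltn_ext _ al (a - s); lia.
case: ifP => Ha; case: ifP => Hb //.
- by move=> /addnI/ext_inj; lia.
- by have := @ltn_ext _ al (a - s); lia.
- by have := @ltn_ext _ al (b - s); lia.
Qed.

(** The patterns of the windows at 0 and at s are independent and uniform.
    Permuting the positions inside each window by al and be is a bijection of
    S_n, so the sum on the left does not change; summing over all al and be
    replaces both patterns by all of S_K, because the products of a fixed
    pattern with the elements of S_K reach every pattern exactly once. *)
Lemma two_window_equidistribution n K s (F : (nat -> nat) -> (nat -> nat) -> nat) :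
  K <= s -> s + K <= n ->
  (forall u u' v v', order_iso K u u' -> order_iso K v v' -> F u v = F u' v') ->
  K`! * K`! * \sum_(tau : 'S_n) F (ext tau) (shift s (ext tau)) =
  n`! * \sum_(al : 'S_K) \sum_(be : 'S_K) F (ext al) (ext be).
Proof.
move=> Ks sKn Fiso.
have cardS m : #|{: 'S_m}| = m`! by rewrite -(card_Sn m); apply: eq_card => x; rewrite inE.
have cst (al be : 'S_K) : \sum_(tau : 'S_n) F (ext tau) (shift s (ext tau)) =
    \sum_(tau : 'S_n) F (ext tau \o ext al) (shift s (ext tau) \o ext be).
  (* The two blocks are disjoint, so each window sees only one factor. *)
  have [|s1 s1E] := @block_perm_exists n K 0 al; first lia.
  have [|s2 s2E] := @block_perm_exists n K s be; first lia.
  rewrite (reindex_inj (mulgI (s1 * s2)%g)); apply: eq_bigr => tau _.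
  apply: Fiso; apply/order_isoP => a b aK bK.
  - have E c : c < K -> ext (s1 * s2 * tau)%g c = ext tau (ext al c).
      move=> cK; rewrite !extM s1E ?add0n ?subn0 ?cK /=; last lia.
      by have := ltn_ext al cK => alK; rewrite s2E; [rewrite ifF //; lia|lia].
    by rewrite /= !E.
  - have E c : c < K -> shift s (ext (s1 * s2 * tau)%g) c
                        = shift s (ext tau) (ext be c).
      move=> cK; rewrite /shift !extM s1E ?ifF; [|lia..].
      by rewrite s2E ?ifT ?addKn //; lia.
    by rewrite /= !E.
have avg (tau : 'S_n) :
    \sum_(al : 'S_K) \sum_(be : 'S_K) F (ext tau \o ext al) (shift s (ext tau) \o ext be)
    = \sum_(al : 'S_K) \sum_(be : 'S_K) F (ext al) (ext be).
  have [|p /order_isoP pE] := @standardization K (ext tau).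
    by move=> a b _ _ /ext_inj.
  have [|q /order_isoP qE] := @standardization K (shift s (ext tau)).
    by move=> a b _ _ /ext_inj/addnI.
  rewrite [RHS](reindex_inj (mulIg p)); apply: eq_bigr => al _.
  rewrite [RHS](reindex_inj (mulIg q)); apply: eq_bigr => be _.
  by apply: Fiso; apply/order_isoP => a b aK bK /=; rewrite !extM -?pE -?qE ?ltn_ext.
transitivity (\sum_(al : 'S_K) \sum_(be : 'S_K) \sum_(tau : 'S_n)
                F (ext tau) (shift s (ext tau))).
  by rewrite !sum_nat_const cardS mulnA.
under eq_bigr => al _ do under eq_bigr => be _ do rewrite (cst al be).
under eq_bigr => al _ do rewrite exchange_big.
rewrite exchange_big /=; under eq_bigr => tau _ do rewrite avg.
by rewrite sum_nat_const cardS.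
Qed.

(** Two independent uniform patterns of length i agree with probability 1/i!:
    for each first pattern, exactly one second pattern is equal to it. *)
Lemma order_iso_window_count n i s : i <= s -> s + i <= n ->
  i`! * \sum_(tau : 'S_n) order_iso i (ext tau) (shift s (ext tau)) = n`!.
Proof.
move=> le_is sin; apply/eqP; rewrite -(eqn_pmul2l (fact_gt0 i)) mulnA.
rewrite (@two_window_equidistribution n i s (fun u v => order_iso i u v)) //.
  under eq_bigr => al _.
    under eq_bigr => be _ do rewrite order_iso_perm.
    rewrite (bigD1 al) //= eqxx big1 ?addn0; last first.
      by move=> be; rewrite eq_sym => /negbTE ->.
    over.
  rewrite sum_nat_const muln1 mulnC; apply/eqP; congr (_ * _).
  by rewrite -(card_Sn i); apply: eq_card => x; rewrite inE.
move=> u u' v v' Hu Hv; congr nat_of_bool; apply/idP/idP => H.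
  by rewrite (order_iso_trans _ (order_iso_trans H Hv)) // order_iso_sym.
by rewrite (order_iso_trans Hu) // (order_iso_trans H) // order_iso_sym.
Qed.

(** * Bifixes of bounded length *)

(** The longest bifix of length at most K, read off from the first window u and
    the last window v of length K alone. *)
Definition longest_match K (u v : nat -> nat) : nat :=
  \max_(1 <= i < K.+1 | order_iso i u (shift (K - i) v)) i.

Definition longest_bifix_upto K n (tau : 'S_n) : nat :=
  \max_(1 <= i < K.+1 | order_iso i (ext tau) (shift (n - i) (ext tau))) i.

Lemma size_exterior n (tau : 'S_n) :
  size (exterior (one_line tau)) = longest_bifix_upto n.-1 tau.
Proof.
case: n tau => [|n] tau.
  by rewrite /exterior /longest_bifix_upto size_one_line !big_geq // size_factor_prefix.
rewrite /exterior size_factor_prefix !size_one_line.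
  rewrite /longest_bifix_upto big_nat_cond [RHS]big_nat_cond; apply: eq_bigl => i.
  by apply: andb_id2l => H; rewrite bifix_atE //; lia.
by apply/bigmax_leqP_seq => i; rewrite mem_index_iota; lia.
Qed.

(** The suffix of length i <= K of tau is the suffix of its last K letters. This
    is what makes the longest short bifix a function of the two windows. *)
Lemma longest_match_window n K (tau : 'S_n) : K <= n ->
  longest_match K (ext tau) (shift (n - K) (ext tau)) = longest_bifix_upto K tau.
Proof.
move=> Kn; rewrite /longest_match big_nat_cond [RHS]big_nat_cond.
apply: eq_bigl => i; apply: andb_id2l => iK.
have E : shift (K - i) (shift (n - K) (ext tau)) =1 shift (n - i) (ext tau).
  by move=> a; rewrite /shift; congr ext; lia.
by apply/order_isoP/order_isoP => H a b ai bi; move: (H a b ai bi); rewrite !E.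
Qed.

Lemma longest_match_iso K u u' v v' : order_iso K u u' -> order_iso K v v' ->
  longest_match K u v = longest_match K u' v'.
Proof.
move=> /order_isoP Hu /order_isoP Hv; rewrite /longest_match big_nat_cond [RHS]big_nat_cond.
apply: eq_bigl => i; apply: andb_id2l => iK.
by apply/order_isoP/order_isoP => H a b ai bi; move: (H a b ai bi);
  rewrite /shift Hu ?Hv //; lia.
Qed.

Lemma longest_bifix_le K n (tau : 'S_n) : longest_bifix_upto K tau <= K.
Proof. by apply/bigmax_leqP_seq => i; rewrite mem_index_iota; lia. Qed.

Lemma longest_bifix_homo K L n (tau : 'S_n) : K <= L ->
  longest_bifix_upto K tau <= longest_bifix_upto L tau.
Proof.
move=> KL; apply/bigmax_leqP_seq => i; rewrite mem_index_iota => iK Pi.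
by apply: leq_bigmax_seq => //; rewrite mem_index_iota; lia.
Qed.

Lemma longest_bifix_le_sum K n (tau : 'S_n) : longest_bifix_upto K tau <=
  \sum_(1 <= i < K.+1) i * order_iso i (ext tau) (shift (n - i) (ext tau)).
Proof.
apply/bigmax_leqP_seq => i iK Pi.
by rewrite (bigD1_seq i) ?iota_uniq //= Pi muln1 leq_addr.
Qed.

(** The bifix lengths are distinct positive integers, so their maximum is at
    least their number. *)
Lemma longest_bifix_ge_count K n (tau : 'S_n) :
  \sum_(1 <= i < K.+1) order_iso i (ext tau) (shift (n - i) (ext tau))
  <= longest_bifix_upto K tau.
Proof.
elim: K => [|K IH]; first by rewrite big_geq.
have -> : longest_bifix_upto K.+1 tau = maxn (longest_bifix_upto K tau)
    (if order_iso K.+1 (ext tau) (shift (n - K.+1) (ext tau)) then K.+1 else 0).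
  by rewrite /longest_bifix_upto big_mkcond big_nat_recr //= -big_mkcond.
rewrite big_nat_recr //=; case: ifP => _ /=; last by rewrite maxn0 addn0.
by rewrite (maxn_idPr _) ?addn1 ?ltnS ?(leq_trans IH) // ?longest_bifix_le ?leqW ?longest_bifix_le.
Qed.

(** * Long bifixes *)

(** A bifix of length n - d says that shifting by d preserves comparisons; then
    so does shifting by any multiple of d, as long as it stays in range. *)
Lemma shift_iterate n (tau : 'S_n) d j a b :
  order_iso (n - d) (ext tau) (shift d (ext tau)) ->
  a + j * d < n -> b + j * d < n ->
  (ext tau a <= ext tau b) = (ext tau (j * d + a) <= ext tau (j * d + b)).
Proof.
move=> /order_isoP H; elim: j => [|j IH] // Ha Hb; rewrite IH; [|nia..].
by rewrite H /shift; [congr (_ <= _); congr ext; nia|nia..].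
Qed.

(** The shift d = n - i is less than n/2. If it is already at least n/4, take
    D = d; otherwise the interval from n/4 to n/2 is longer than d and contains
    a multiple of d. The lower bound on D makes the repetition improbable, and
    the upper bound keeps the two blocks of length D inside tau. *)
Lemma long_bifix_repetition n (tau : 'S_n) i : n < i.*2 -> i < n ->
  order_iso i (ext tau) (shift (n - i) (ext tau)) ->
  exists2 D, n %/ 4 <= D <= n./2 & order_iso D (ext tau) (shift D (ext tau)).
Proof.
move=> ni lt_in H; set d := n - i in H.
have [j jd] : exists j, n %/ 4 <= j * d <= n./2.
  case: (leqP (n %/ 4) d) => dn; first by exists 1; lia.
  (* n/4 divided by d, rounded up. *)
  exists ((n %/ 4 + d.-1) %/ d).
  have d0 : 0 < d by lia.
  have := divn_eq (n %/ 4 + d.-1) d; have := ltn_pmod (n %/ 4 + d.-1) d0.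
  by set x := _ %/ d; set y := _ %% d; nia.
exists (j * d) => //; apply/order_isoP => a b aD bD.
apply: shift_iterate; [|lia..].
by rewrite subKn // ltnW.
Qed.

(** Either the longest bifix is short, or some repetition of
    [long_bifix_repetition] occurs and the trivial bound n is paid for it. *)
Lemma longest_bifix_le_short n (tau : 'S_n) :
  longest_bifix_upto n.-1 tau <= longest_bifix_upto n./2 tau +
    n * \sum_(n %/ 4 <= D < n./2.+1) order_iso D (ext tau) (shift D (ext tau)).
Proof.
apply/bigmax_leqP_seq => i; rewrite mem_index_iota => ni Pi.
case: (leqP i n./2) => i2.
  by rewrite -[i]addn0; apply: leq_add => //; apply: leq_bigmax_seq; rewrite // mem_index_iota; lia.
have [||D nD PD] := @long_bifix_repetition n tau i _ _ Pi; [lia..|].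
rewrite (@bigD1_seq _ _ _ _ _ D) ?iota_uniq ?mem_index_iota //= ?PD.
by rewrite mulnDr muln1; lia.
Qed.

End Combinatorics.

(** * Expectations *)

Section Expectation.
Set Implicit Arguments.
Unset Strict Implicit.
Unset Printing Implicit Defensive.
Variable R : realType.

Definition mean n (f : 'S_n -> nat) : R := (\sum_tau f tau)%N%:R / n`!%:R.

Lemma ler_mean n (f g : 'S_n -> nat) :
  (forall tau, (f tau <= g tau)%N) -> mean f <= mean g.
Proof.
by move=> fg; rewrite ler_wpM2r ?invr_ge0 ?ler0n // ler_nat leq_sum.
Qed.

Lemma meanD n (f g : 'S_n -> nat) :
  mean (fun tau => f tau + g tau)%N = mean f + mean g.
Proof. by rewrite /mean big_split natrD mulrDl. Qed.

Lemma meanMl n k (f : 'S_n -> nat) :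
  mean (fun tau => k * f tau)%N = k%:R * mean f.
Proof. by rewrite /mean -big_distrr natrM mulrA. Qed.

Lemma mean_sum n I (r : seq I) (f : I -> 'S_n -> nat) :
  mean (fun tau => \sum_(i <- r) f i tau)%N = \sum_(i <- r) mean (f i).
Proof. by rewrite /mean exchange_big natr_sum mulr_suml. Qed.

Lemma mean_order_iso_window n i s : (i <= s)%N -> (s + i <= n)%N ->
  mean (fun tau : 'S_n => order_iso i (ext tau) (shift s (ext tau))) = i`!%:R^-1.
Proof.
move=> le_is sin; rewrite /mean -(order_iso_window_count le_is sin) natrM.
rewrite invfM mulrCA mulfV ?mulr1 //; apply/eqP => S0.
have /eqP := order_iso_window_count le_is sin.
move/eqP: S0; rewrite pnatr_eq0 => /eqP ->.
by rewrite muln0 eq_sym gtn_eqF ?fact_gt0.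
Qed.

(** The shortest words whose prefix and suffix of length K are disjoint have
    length 2K; [mean_longest_bifix_upto] shows that longer words give the same
    mean. *)
Definition short_mean K : R := mean (@longest_bifix_upto K K.*2).

Lemma mean_longest_bifix_upto K n : (K.*2 <= n)%N ->
  mean (@longest_bifix_upto K n) = short_mean K.
Proof.
have H m : (K.*2 <= m)%N -> mean (@longest_bifix_upto K m) =
    (\sum_(al : 'S_K) \sum_(be : 'S_K) longest_match K (ext al) (ext be))%N%:R
    / (K`! * K`!)%:R.
  move=> Km; apply/eqP; rewrite eqr_div ?pnatr_eq0 -?lt0n ?muln_gt0 ?fact_gt0 //.
  rewrite -!natrM; apply/eqP; congr (_%:R); rewrite mulnC.
  rewrite [RHS]mulnC -(@two_window_equidistribution m K (m - K)); [|lia..|].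
    congr (_ * _)%N; apply: eq_bigr => tau _.
    by rewrite longest_match_window //; lia.
  exact: longest_match_iso.
by move=> Kn; rewrite /short_mean !H.
Qed.

Lemma short_mean_nondecreasing : {homo short_mean : K L / (K <= L)%N >-> K <= L}.
Proof.
move=> K L KL; rewrite -(@mean_longest_bifix_upto K L.*2) ?leq_double //.
by apply: ler_mean => tau; exact: longest_bifix_homo.
Qed.

(** The maximum of the bifix lengths is at most their sum, and i/i! is 1/(i-1)!,
    so the bound is a partial sum of the series of e. *)
Lemma short_mean_ub K : short_mean K <= series (exp_coeff 1) K.
Proof.
apply: le_trans (ler_mean (@longest_bifix_le_sum K _)) _.
rewrite mean_sum seriesEnat big_add1 le_eqVlt; apply/orP; left; apply/eqP.
apply: eq_big_nat => i iK; rewrite meanMl mean_order_iso_window; [|lia..].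
by rewrite /exp_coeff /= expr1n mul1r factS natrM invfM mulrA divff ?mul1r ?pnatr_eq0.
Qed.

(** Counting bifixes gives the series of e without its term of index 0. *)
Lemma short_mean_lb K : series (exp_coeff 1) K.+1 - 1 <= short_mean K.
Proof.
apply: le_trans (ler_mean (@longest_bifix_ge_count K _)).
rewrite mean_sum seriesEnat /= [X in X - 1]big_nat_recl // {1}/exp_coeff /= expr0 fact0 divr1 addrC addKr.
rewrite big_add1 le_eqVlt; apply/orP; left; apply/eqP.
apply: eq_big_nat => i iK; rewrite mean_order_iso_window; [|lia..].
by rewrite /exp_coeff /= expr1n mul1r.
Qed.

Lemma expected_exterior_sizeE n :
  expected_exterior_size R n = mean (@longest_bifix_upto n.-1 n).
Proof.
rewrite /expected_exterior_size /mean natr_sum; congr (_ / _%:R).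
  by apply: eq_bigr => tau _; rewrite size_exterior.
by rewrite -(card_Sn n); apply: eq_card => x; rewrite inE.
Qed.

Lemma expected_exterior_size_lb n :
  short_mean n./2 <= expected_exterior_size R n.
Proof.
case: (posnP n./2) => [->|n2].
  rewrite /short_mean /mean big1 ?mul0r; last first.
    by move=> tau _; apply/eqP; rewrite -leqn0 longest_bifix_le.
  by rewrite divr_ge0 ?sumr_ge0.
rewrite expected_exterior_sizeE -(@mean_longest_bifix_upto _ n); last lia.
by apply: ler_mean => tau; apply: longest_bifix_homo; lia.
Qed.

(** With q = n/4 rounded down, the error is at most (4q + 3)(2q + 2)/q!, which
    is below 8 * 4^q/q! because q + 1 <= 2^q: the general term of a convergent
    exponential series. *)
Lemma expected_exterior_size_ub n :
  expected_exterior_size R n <= short_mean n./2 + 8 * exp_coeff 4 (n %/ 4)%N.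
Proof.
rewrite expected_exterior_sizeE -(@mean_longest_bifix_upto _ n); last lia.
apply: le_trans (ler_mean (@longest_bifix_le_short n)) _.
rewrite meanD lerD2l meanMl mean_sum.
set q := (n %/ 4)%N.
apply: (@le_trans _ _ (n%:R * \sum_(q <= D < n./2.+1) q`!%:R^-1)).
  rewrite ler_wpM2l // ler_sum_nat // => D qD.
  rewrite mean_order_iso_window; [|lia..].
  by rewrite lef_pV2 ?posrE ?ltr0n ?fact_gt0 // ler_nat leq_fact; lia.
rewrite sumr_const_nat -(mulr_natl _^-1) mulrA -natrM /exp_coeff /= mulrA.
rewrite ler_wpM2r ?invr_ge0 // -natrX -natrM ler_nat.
have /leq_mul H : (q.+1 <= 2 ^ q)%N by exact: ltn_expl.
have := H _ _ (ltn_expl q (isT : 1 < 2)%N); rewrite -expnMn -[(2 * 2)%N]/4%N.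
have : (n <= 4 * q + 3)%N by rewrite /q; lia.
nia.
Qed.

End Expectation.

Theorem theorem6p5 (R : realType) :
  cvgn (expected_exterior_size R) /\
  expR 1 - 1 <= limn (expected_exterior_size R) <= expR 1.
Proof.
have series_le K : series (exp_coeff (1 : R)) K <= expR 1.
  apply: nondecreasing_cvgn_le; last exact: is_cvg_series_exp_coeff.
  by apply: nondecreasing_series => n _ _; rewrite /exp_coeff /= divr_ge0 ?exprn_ge0.
have short_le K : short_mean R K <= expR 1.
  exact: le_trans (short_mean_ub R K) (series_le K).
have short_cvg : cvgn (short_mean R).
  apply: nondecreasing_is_cvgn; first exact: short_mean_nondecreasing.
  by exists (expR 1) => _ [K _ <-].
have half_cvg : short_mean R n./2 @[n --> \oo] --> limn (short_mean R).
  apply: cvg_comp short_cvg; apply/cvgnyPge => A.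
  by near=> n; have : (A.*2 <= n)%N by [near: n; exact: nbhs_infty_ge]; lia.
have err_cvg : 8 * exp_coeff (4 : R) (n %/ 4)%N @[n --> \oo] --> (0 : R).
  rewrite -[X in _ --> X](mulr0 8); apply: cvgMr.
  apply: cvg_comp (cvg_series_cvg_0 (is_cvg_series_exp_coeff (4 : R))).
  apply/cvgnyPge => A.
  by near=> n; have : (4 * A <= n)%N by [near: n; exact: nbhs_infty_ge]; lia.
have E_cvg : expected_exterior_size R n @[n --> \oo] --> limn (short_mean R).
  apply: (squeeze_cvgr _ half_cvg); last first.
    by rewrite -[X in _ --> X]addr0; exact: cvgD half_cvg err_cvg.
  by near=> n; rewrite expected_exterior_size_lb expected_exterior_size_ub.
split; first by apply/cvg_ex; exists (limn (short_mean R)).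
rewrite (cvg_lim _ E_cvg) //; apply/andP; split; last first.
  by apply: limr_le => //; near=> K.
rewrite lerBlDr; apply: limr_le; first exact: is_cvg_series_exp_coeff.
near=> K.
rewrite -lerBlDr; apply: le_trans (nondecreasing_cvgn_le (@short_mean_nondecreasing R) short_cvg K).
apply: le_trans (short_mean_lb R K).
rewrite lerD2r.
by apply: nondecreasing_series => // n _ _; rewrite /exp_coeff /= divr_ge0 ?exprn_ge0.
Unshelve. all: by end_near.
Qed.
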